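(* Let $X$ be a Banach space. Then $X$ is B-convex if and only if the following holds: for every $c\ge 1$ there exist $c_1>0$ and $q\in(0,1)$ (depending only on $c$ and $X$) such that, for every closed subspace $Y$ of $X$, every $c$-ARS in $Y$ is a $(c_1,q)$-quick representing system in $Y$.
   Context: Banach spaces are real and $B(Y)$ is the closed unit ball of $Y$. A Banach space $X$ is B-convex if it does not contain $l_1^n$ uniformly, i.e. there is no constant $\lambda$ such that for every $n\ge1$ some $n$-dimensional subspace of $X$ is $\lambda$-isomorphic to $l_1^n$ (equivalently, $X$ has some type $p>1$). A set $D$ in a Banach space $Y$ is a $c$-ARS ($c$-absolutely representing system) in $Y$ if every $x\in B(Y)$ can be written as $x=\sum_{i=1}^\infty a_i x_i$ with scalars $a_i$, elements $x_i\in D$ (repetitions allowed), and $\sum_{i=1}^\infty\|a_i x_i\|\le c$. For $c>0$ and $q\in(0,1)$, a set $D\subset Y$ is a $(c,q)$-quick representing system in $Y$ if every $x\in Y$ can be written as $x=\sum_{i=1}^\infty a_i x_i$ with scalars $a_i$, elements $x_i\in D$ (repetitions allowed), and $\|a_i x_i\|\le c q^{i-1}\|x\|$ for all $i\ge1$. *)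

(* Defs.v *)
From HB Require Import structures.
From mathcomp Require Import all_boot all_order all_algebra.
From mathcomp Require Import all_classical all_reals all_analysis.

Set Implicit Arguments.
Unset Strict Implicit.
Unset Printing Implicit Defensive.

Import Order.TTheory GRing.Theory Num.Theory.
Import numFieldNormedType.Exports.

Local Open Scope classical_set_scope.
Local Open Scope ring_scope.

Definition linear_subspace (R : realType) (X : normedModType R)
    (Y : set X) : Prop :=
  submod_closed (mem Y).

Definition closed_subspace (R : realType) (X : normedModType R)
    (Y : set X) : Prop :=
  linear_subspace Y /\ closed Y.

(* The library's norm on 'rV[R]_n is the sup norm, so l_1^n is 'rV[R]_n taken
   with this norm instead. *)
Definition l1norm (R : realType) (n : nat) (v : 'rV[R]_n) : R :=
  \sum_(i < n) `|v 0 i|.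

(* E is lambda-isomorphic to l_1^n: there is a linear bijection T from l_1^n
   onto E with ||T|| ||T^-1|| <= lambda, where A and B are bounds for ||T|| and
   ||T^-1||.  As T is a linear bijection, E has dimension n. *)
Definition isomorphic_l1n (R : realType) (X : normedModType R)
    (lambda : R) (n : nat) (E : set X) : Prop :=
  exists T : {linear 'rV[R]_n -> X},
    set_bij [set: 'rV[R]_n] E T /\
    exists A B : R,
      [/\ 0 <= A, 0 <= B,
          forall v : 'rV[R]_n, `|T v| <= A * l1norm v,
          forall v : 'rV[R]_n, l1norm v <= B * `|T v| &
          A * B <= lambda].

Definition contains_l1n_uniformly (R : realType) (X : normedModType R) : Prop :=
  exists lambda : R, forall n : nat, (1 <= n)%N ->
    exists E : set X, linear_subspace E /\ isomorphic_l1n lambda n E.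

Definition B_convex (R : realType) (X : normedModType R) : Prop :=
  ~ contains_l1n_uniformly X.

Definition is_ARS (R : realType) (X : normedModType R)
    (c : R) (Y D : set X) : Prop :=
  D `<=` Y /\
  forall x : X, Y x -> `|x| <= 1 ->
    exists (a : nat -> R) (d : nat -> X),
      [/\ forall i, D (d i),
          series (fun i => a i *: d i) @ \oo --> x &
          (\sum_(0 <= i <oo) (`|a i *: d i|)%:E <= c%:E)%E].

(* Series are indexed from 0, so the i-th term is bounded using q ^+ i. *)
Definition is_quick_representing_system (R : realType) (X : normedModType R)
    (c q : R) (Y D : set X) : Prop :=
  D `<=` Y /\
  forall x : X, Y x ->
    exists (a : nat -> R) (d : nat -> X),
      [/\ forall i, D (d i),
          series (fun i => a i *: d i) @ \oo --> x &
          forall i, `|a i *: d i| <= c * q ^+ i * `|x|].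

(* Main.v *)
Require Import Defs.
From HB Require Import structures.
From mathcomp Require Import all_boot all_order all_algebra.
From mathcomp Require Import all_classical all_reals all_analysis.
From mathcomp Require Import zify ring lra.
Import Order.TTheory GRing.Theory Num.Theory.
Import numFieldNormedType.Exports.
Local Open Scope classical_set_scope.
Local Open Scope ring_scope.

(** If [X] does not contain the spaces l_1^n with constant 2, then for some [n]
    any [n] unit vectors admit signs making the norm of the signed sum at most
    [n - 1/2].  Multiplying block sizes turns this into a bound
    [A * rho ^+ i * 2 ^ i], with [rho < 1], for [2 ^ i] unit vectors.
    Given a sum of [2 K] vectors, one of the two sign classes has at most [K]
    elements, and twice its sum differs from the whole by the signed sum; so sums
    of [2 ^ J] multiples of elements of [D], each of norm at most [C / 2 ^ J],
    can be halved repeatedly, with a geometric total error, down to a fixed number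
    [m] of terms.  Hence every [x] in [Y] is within [|x| / 2] of a sum of [m]
    multiples of elements of [D], and iterating on the remainder gives a quick
    representation.
    Conversely, the unit vectors of a [lambda]-copy of l_1^n form a
    [lambda]-ARS.  If it were quick with constants independent of [n], the image
    of (1, ..., 1) would be approximated within a quarter of its norm by a number
    of terms independent of [n], while half of the coordinates are missed. *)

(** * Signs that make a signed sum small *)

(** Vectors of the unit ball rather than unit vectors: zero can then serve as padding, and block
    sums only have to be scaled into the ball. *)
Definition sign_balanced (R : realType) (X : normedModType R) (n : nat)
    (b : R) : Prop :=
  forall u : nat -> X, (forall i, `|u i| <= 1) ->
    exists e : nat -> bool, `|\sum_(0 <= i < n) (-1) ^+ e i *: u i| <= b.

Lemma sign_balancedW (R : realType) (X : normedModType R) (n : nat) (b b' : R) :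
  b <= b' -> sign_balanced R X n b -> sign_balanced R X n b'.
Proof.
by move=> bb' H u /H[e He]; exists e; exact: le_trans bb'.
Qed.

Lemma norm_signZ (R : realType) (X : normedModType R) (b : bool) (x : X) :
  `|(-1) ^+ b *: x| = `|x|.
Proof. by rewrite normrZ normr_sign mul1r. Qed.

Lemma sign_balanced_trivial (R : realType) (X : normedModType R) (n : nat) :
  sign_balanced R X n n%:R.
Proof.
move=> u u1; exists (fun=> false).
apply: le_trans (ler_norm_sum _ _ _) _.
rewrite -[n%:R]/(1 *+ n) -[X in _ *+ X](subn0 n) -sumr_const_nat.
by apply: ler_sum => i _; rewrite norm_signZ.
Qed.

Lemma sign_balancedD1 (R : realType) (X : normedModType R) (n : nat) (b : R) :
  sign_balanced R X n b -> sign_balanced R X n.+1 (b + 1).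
Proof.
move=> H u u1; have [e He] := H u u1; exists e.
rewrite big_nat_recr //=; apply: le_trans (ler_normD _ _) _.
by rewrite lerD // norm_signZ.
Qed.

(** Cut the vectors into [n] blocks of length [k]. Signs inside a block bring its sum down to norm
    [b']; divided by [b'], the block sums are [n] vectors of the unit ball, and one further sign per
    block balances them. *)
Lemma sign_balancedM (R : realType) (X : normedModType R) (n k : nat)
    (b b' : R) :
  (0 < k)%N -> 0 < b' -> sign_balanced R X n b -> sign_balanced R X k b' ->
  sign_balanced R X (n * k) (b * b').
Proof.
move=> k0 b0 Hn Hk u u1.
have /choice[e He] : forall j, exists e : nat -> bool,
    `|\sum_(0 <= i < k) (-1) ^+ e i *: u (i + j * k)%N| <= b'.
  by move=> j; apply: Hk => i; exact: u1.
pose v j := b'^-1 *: \sum_(0 <= i < k) (-1) ^+ e j i *: u (i + j * k)%N.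
have v1 j : `|v j| <= 1.
  by rewrite normrZ gtr0_norm ?invr_gt0// mulrC ler_pdivrMr// mul1r.
have [e' He'] := Hn v v1.
(* Each vector gets the product of its block's sign and its sign within the block, which on booleans
   is exclusive or. *)
exists (fun i => e' (i %/ k)%N (+) e (i %/ k)%N (i %% k)%N).
rewrite big_nat_mul.
have -> : \sum_(0 <= i < n) \sum_(i * k <= j < i.+1 * k)
    (-1) ^+ (e' (j %/ k)%N (+) e (j %/ k)%N (j %% k)%N) *: u j =
    b' *: \sum_(0 <= i < n) (-1) ^+ e' i *: v i.
  rewrite scaler_sumr; apply: eq_bigr => i _.
  rewrite scalerA mulrC -scalerA /v (scalerA b') mulfV ?gt_eqF// scale1r.
  rewrite mulSn -{1}(add0n (i * k)%N) big_addn addnK scaler_sumr.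
  apply: eq_big_nat => j /andP[_ jk].
  rewrite divnDMl// (addnC j) modnMDl divn_small// modn_small// add0n addnC.
  by rewrite scalerA -signr_addb.
by rewrite normrZ gtr0_norm// mulrC ler_wpM2r// ltW.
Qed.

Lemma bernoulli_sub (R : realDomainType) (x : R) (n : nat) :
  0 <= x -> x <= 1 -> 1 - n%:R * x <= (1 - x) ^+ n.
Proof.
move=> x0 x1; elim: n => [|n IH]; first by rewrite mul0r subr0 expr0.
rewrite exprS; apply: le_trans (ler_wpM2l _ IH); last by rewrite subr_ge0.
rewrite -subr_ge0 -natr1.
have -> : (1 - x) * (1 - n%:R * x) - (1 - (n%:R + 1) * x) = n%:R * (x * x).
  by ring.
by rewrite mulr_ge0// mulr_ge0.
Qed.

(* Tensor power trick: a gain of a constant at one size n iterates to a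
   geometric gain along the powers of 2. *)
Lemma sign_balanced_exp2 (R : realType) (X : normedModType R) (n : nat) :
  sign_balanced R X n (n%:R - 2^-1) ->
  exists A rho : R, [/\ 1 <= A, 0 < rho, rho < 1 &
    forall i, sign_balanced R X (2 ^ i) (A * rho ^+ i * (2 ^ i)%:R)].
Proof.
move=> Hn.
(* Padding up to a power of 2 preserves the gain of 1/2, as each added vector raises the bound by at
   most 1. *)
pose s := n.+1; have ns : (n <= 2 ^ s)%N.
  by apply: leq_trans (ltnW (ltn_expl _ (ltnSn 1))); rewrite /s.
have Hs : sign_balanced R X (2 ^ s) ((2 ^ s)%:R - 2^-1).
  rewrite -(subnK ns); elim: (2 ^ s - n)%N => [|d IH]; first by rewrite add0n.
  rewrite addSn; apply: sign_balancedW (sign_balancedD1 _ _ _ _ IH).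
  by rewrite -natr1; lra.
set N := (2 ^ s)%N in Hs *.
have N1 : 1 <= N%:R :> R by rewrite ler1n expn_gt0.
have s1 : 1 <= s%:R :> R by rewrite ler1n.
(* Chosen so that [s * x = 1 / (2 N)]; Bernoulli's inequality then gives
   [rho ^+ s >= 1 - 1 / (2 N)], the relative gain at size [N]. *)
pose x : R := (2 * N%:R * s%:R)^-1.
have x0 : 0 < x by rewrite invr_gt0; nra.
have x1 : x <= 2^-1 by rewrite lef_pV2 ?posrE; nra.
pose rho := 1 - x.
have r0 : 0 < rho by rewrite /rho; lra.
have r1 : rho < 1 by rewrite /rho; lra.
have rs : (N%:R - 2^-1) <= rho ^+ s * N%:R.
  rewrite -ler_pdivrMr; last by lra.
  apply: (@le_trans _ _ (1 - s%:R * x)); last by apply: bernoulli_sub; lra.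
  rewrite mulrBl mulfV ?gt_eqF//; last by lra.
  rewrite /x -subr_ge0.
  suff -> : s%:R * (2 * N%:R * s%:R)^-1 = 2^-1 / N%:R :> R by lra.
  by field; rewrite !gt_eqF//; lra.
have rs0 : 0 < rho ^+ s by rewrite exprn_gt0.
(* The factor [(rho ^+ s)^-1] makes the trivial bound suffice for exponents below [s]; from [s] on,
   a factor [2 ^ s] is split off and induction applies. *)
exists (rho ^+ s)^-1, rho; split=> //.
  by rewrite invf_ge1// exprn_ile1// ltW.
elim/ltn_ind => i IH.
have [iS|Si] := ltnP i s.
  apply: sign_balancedW (sign_balanced_trivial _ _ _).
  rewrite ler_peMl// mulrC ler_pdivlMr// mul1r.
  by apply: ler_wiXn2l; [exact: ltW..|exact: ltnW].
have iE : i = (s + (i - s))%N by rewrite subnKC.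
have /IH IH' : (i - s < i)%N by rewrite ltn_subrL; apply/andP; split => //; lia.
rewrite {1}iE expnD.
have b0 : 0 < (rho ^+ s)^-1 * rho ^+ (i - s) * (2 ^ (i - s))%:R.
  by rewrite !mulr_gt0 ?invr_gt0 ?exprn_gt0// ltr0n expn_gt0.
apply: sign_balancedW (sign_balancedM _ _ _ _ _ _ _ b0 Hs IH').
  apply: le_trans (ler_wpM2r (ltW b0) rs) _.
  by rewrite {3 4}iE exprD expnD natrM; set a := (_)^-1; lra.
by rewrite expn_gt0.
Qed.

(** * B-convexity gives a gain at some size *)

(** If size [n] fails, some [u] in the unit ball has all its signed sums above [n - 1/2], and
    mapping the basis of l_1^n to [u] is an embedding with constant 2. Failure at every size would
    contradict B-convexity. *)
Lemma B_convex_sign_balanced (R : realType) (X : normedModType R) :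
  B_convex X -> exists n, sign_balanced R X n (n%:R - 2^-1).
Proof.
move=> bX; apply: contrapT => nH; apply: bX; exists 2 => n n1.
have : ~ sign_balanced R X n (n%:R - 2^-1) by move=> ?; apply: nH; exists n.
move=> /existsNP[u /not_implyP[u1 /forallNP Hu]].
have {}Hu (e : nat -> bool) :
    n%:R - 2^-1 < `|\sum_(i < n) (-1) ^+ e i *: u i|.
  by rewrite -(big_mkord predT (fun i => (-1) ^+ e i *: u i)) ltNge; apply/negP.
pose f (v : 'rV[R]_n) : X := \sum_(i < n) v 0 i *: u i.
have flin : linear f.
  move=> a v w; rewrite /f scaler_sumr -big_split /=.
  by apply: eq_bigr => i _; rewrite !mxE scalerDl scalerA.
pose T : {linear 'rV[R]_n -> X} := HB.pack f (GRing.isLinear.Build _ _ _ _ f flin).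
have upper v : `|T v| <= 1 * l1norm v.
  rewrite mul1r; apply: le_trans (ler_norm_sum _ _ _) _.
  by apply: ler_sum => i _; rewrite normrZ ler_piMr.
(* If M bounds the coordinates, then replacing them by [M] with the same signs
   changes the norm by at most [n M - l1norm v]. *)
have lower v : l1norm v <= 2 * `|T v|.
  pose M : R := \big[Num.max/0]_(i < n) `|v 0 i|.
  have vM i : `|v 0 i| <= M by exact: (le_bigmax _ (fun i => `|v 0 i|)).
  have M0 : 0 <= M by exact: bigmax_ge_id.
  have Ml : M <= l1norm v.
    apply: bigmax_le => [|i _]; first exact: sumr_ge0.
    by rewrite /l1norm (bigD1 i)//= lerDl sumr_ge0.
  (* Signs are indexed by [nat]; outside ['I_n] they take a default that the sum never reads. *)
  pose e k := if insub k is Some i then v 0 i < 0 else false.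
  have eE (i : 'I_n) : e i = (v 0 i < 0) by rewrite /e valK.
  have vE i : v 0 i = `|v 0 i| * (-1) ^+ e i.
    by rewrite eE mulrC; rewrite -realEsign ?num_real.
  have := Hu e; move=> /ltW /(ler_wpM2l M0) He.
  have dE : M *: (\sum_(i < n) (-1) ^+ e i *: u i) =
      T v + \sum_(i < n) ((M - `|v 0 i|) * (-1) ^+ e i) *: u i.
    rewrite /T /= /f -big_split scaler_sumr /=; apply: eq_bigr => i _.
    by rewrite -scalerDl {1}vE scalerA -mulrDl addrC subrK.
  have dn : `|\sum_(i < n) ((M - `|v 0 i|) * (-1) ^+ e i) *: u i| <=
      n%:R * M - l1norm v.
    apply: le_trans (ler_norm_sum _ _ _) _.
    have -> : n%:R * M - l1norm v = \sum_(i < n) (M - `|v 0 i|).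
      by rewrite sumrB sumr_const card_ord mulr_natl.
    apply: ler_sum => i _.
    by rewrite normrZ normrM normr_sign mulr1 ger0_norm ?subr_ge0// ler_piMr ?subr_ge0.
  (* Altogether [l1norm v <= |T v| + M / 2], and [M <= l1norm v] absorbs the last term. *)
  have := ler_normD (T v) (\sum_(i < n) ((M - `|v 0 i|) * (-1) ^+ e i) *: u i).
  rewrite -dE normrZ (ger0_norm M0); move: He Ml dn; lra.
exists (range T); split.
  split=> [|a x y].
    by rewrite inE; exists 0 => //; rewrite linear0.
  rewrite !inE => -[v _ <-] [w _ <-].
  by exists (a *: v + w) => //; rewrite linearP.
exists T; split.
  split=> // v w _ _ Tvw.
  have : l1norm (v - w) <= 0.
    by apply: le_trans (lower _) _; rewrite linearB Tvw subrr normr0 mulr0.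
  move=> l0; apply/rowP => i; apply/eqP; rewrite -subr_eq0 -normr_le0.
  have -> : v 0 i - w 0 i = (v - w) 0 i by rewrite !mxE.
  by apply: le_trans l0; rewrite /l1norm (bigD1 i)//= lerDl sumr_ge0.
by exists 1, 2; split=> //; rewrite mul1r.
Qed.

(** * Halving the number of summands *)

Definition sums_of {R : realType} {X : normedModType R} (G : set X) (r : R)
    (K : nat) : set X :=
  [set y | exists s : seq X, [/\ (size s <= K)%N,
     {in s, forall v, G v /\ `|v| <= r} & y = \sum_(v <- s) v]].

(** The signs split the terms into two classes whose sums differ by at most [r * b]. Replacing the
    larger class by a second copy of the smaller one leaves at most [K] terms, each doubled. *)
Lemma sums_of_halving (R : realType) (X : normedModType R) (G : set X) (b r : R)
    (K : nat) (y : X) :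
  (forall a v, G v -> G (a *: v)) -> 0 < r ->
  sign_balanced R X (2 * K) b -> sums_of G r (2 * K) y ->
  exists2 z, sums_of G (2 * r) K z & `|y - z| <= r * b.
Proof.
move=> GZ r0 Hb [s [sK Gs ->]].
(* Reading past the end gives 0, so [s] acts as [2 * K] vectors; the filter on [size s] below keeps
   only true entries, which are known to lie in [G]. *)
pose u i := nth 0 s i.
have uE (P : pred nat) : {in [seq u i | i <- iota 0 (2 * K) & P i && (i < size s)%N],
    forall v, G v /\ `|v| <= r}.
  by move=> v /mapP[i]; rewrite mem_filter => /andP[/andP[_ si] _] ->; apply/Gs/mem_nth.
have ur i : `|r^-1 *: u i| <= 1.
  rewrite normrZ gtr0_norm ?invr_gt0// mulrC ler_pdivrMr// mul1r /u.
  have [si|si] := ltnP i (size s); last by rewrite nth_default// normr0 ltW.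
  by have [] := Gs _ (mem_nth 0 si).
have [e He] := Hb _ ur.
pose t (P : pred nat) := [seq u i | i <- iota 0 (2 * K) & P i && (i < size s)%N].
have sumt P : \sum_(v <- t P) v = \sum_(0 <= i < 2 * K | P i) u i.
  rewrite /t big_map big_filter /index_iota subn0.
  rewrite [RHS](bigID (fun i => i < size s)%N) /= [X in _ + X]big1 ?addr0// => i.
  by case/andP=> _; rewrite -leqNgt => si; rewrite /u nth_default.
have sE : \sum_(v <- s) v = \sum_(v <- t e) v + \sum_(v <- t (predC e)) v.
  rewrite !sumt -[RHS](bigID e predT) /= (big_nth 0).
  rewrite [RHS](@big_cat_nat _ _ _ (size s))//= [X in _ = _ + X]big1_seq ?addr0// => i /andP[_].
  by rewrite mem_index_iota => /andP[/(nth_default 0) si _].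
have dE : r^-1 *: (\sum_(v <- t (predC e)) v - \sum_(v <- t e) v) =
    \sum_(0 <= i < 2 * K) (-1) ^+ e i *: (r^-1 *: u i).
  rewrite !sumt [RHS](bigID e) /= scalerBr addrC; congr (_ + _).
    rewrite scaler_sumr; apply: eq_bigr => i /negbTE ei.
    by rewrite ei expr0 scale1r.
  rewrite -scaleNr scaler_sumr; apply: eq_bigr => i ei.
  by rewrite ei expr1 [RHS]scalerA mulN1r.
have dr : `|\sum_(v <- t (predC e)) v - \sum_(v <- t e) v| <= r * b.
  by move: He; rewrite -dE normrZ gtr0_norm ?invr_gt0// mulrC ler_pdivrMr// mulrC.
have main P : (size (t P) <= K)%N ->
    sums_of G (2 * r) K (2 *: \sum_(v <- t P) v).
  move=> tK; exists [seq 2 *: v | v <- t P]; split.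
  - by rewrite size_map.
  - move=> _ /mapP[v /uE [Gv vr] ->]; split; first exact: GZ.
    by rewrite normrZ normr_nat ler_wpM2l.
  - by rewrite [RHS]big_map scaler_sumr.
have size2 : (size (t e) + size (t (predC e)) <= 2 * K)%N.
  rewrite /t !size_map !size_filter -count_predUI.
  rewrite [X in (_ + X)%N](@eq_count _ _ pred0) ?count_pred0 ?addn0.
    by apply: leq_trans (count_size _ _) _; rewrite size_iota.
  by move=> i /=; case: (e i); rewrite /= ?andbF.
have [teK|teK] := leqP (size (t e)) K.
  exists (2 *: \sum_(v <- t e) v); first exact: main.
  rewrite sE; apply: le_trans dr; rewrite le_eqVlt; apply/orP; left; apply/eqP.
  by congr `|_|; rewrite scaler_nat mulr2n opprD addrACA subrr add0r.
exists (2 *: \sum_(v <- t (predC e)) v); first by apply: main; lia.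
rewrite sE; apply: le_trans dr; rewrite le_eqVlt; apply/orP; left; apply/eqP.
rewrite distrC.
by congr `|_|; rewrite scaler_nat mulr2n opprD addrACA subrr addr0.
Qed.

(** Passing from [2 ^ i] to [2 ^ i.-1] terms costs radius times balance, [C * A * rho ^+ i]. The
    costs form a geometric sum; the bound omits a factor [rho] from its exact value, and [t] in the
    proof is the resulting slack. *)
Lemma sums_of_descend (R : realType) (X : normedModType R) (G : set X)
    (A rho C : R) (j d : nat) (y : X) :
  (forall a v, G v -> G (a *: v)) -> 0 < C -> 0 <= A -> 0 < rho -> rho < 1 ->
  (forall i, sign_balanced R X (2 ^ i) (A * rho ^+ i * (2 ^ i)%:R)) ->
  sums_of G (C / (2 ^ (j + d))%:R) (2 ^ (j + d)) y ->
  exists2 z, sums_of G (C / (2 ^ j)%:R) (2 ^ j) z &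
    `|y - z| <= C * A * (rho ^+ j - rho ^+ (j + d)) / (1 - rho).
Proof.
move=> GZ C0 A0 r0 r1 Hb; elim: d y => [|d IH] y.
  rewrite addn0 => Hy; exists y => //.
  by rewrite !subrr normr0 mulr0 mul0r.
have p0 i : 0 < (2 ^ i)%:R :> R by rewrite ltr0n expn_gt0.
rewrite addnS {2}expnS => Hy.
have b : sign_balanced R X (2 * 2 ^ (j + d))
    (A * rho ^+ (j + d).+1 * (2 ^ (j + d).+1)%:R).
  by rewrite -expnS; exact: Hb.
have [|z Hz yz] := sums_of_halving _ _ _ _ _ _ _ GZ _ b Hy; first exact: divr_gt0.
have e2 : 2 * (C / (2 ^ (j + d).+1)%:R) = C / (2 ^ (j + d))%:R.
  by rewrite expnS natrM; field; rewrite ?gt_eqF.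
rewrite e2 in Hz; have [w Hw zw] := IH _ Hz; exists w => //.
have -> : y - w = (y - z) + (z - w) by rewrite addrA subrK.
apply: le_trans (ler_normD _ _) _; apply: le_trans (lerD yz zw) _.
have := p0 (j + d).+1; have := exprn_ge0 (j + d) (ltW r0); rewrite exprS.
move: (2 ^ _)%:R (rho ^+ j) (rho ^+ (j + d)) => p a b' b'0 pp.
rewrite -subr_ge0; set t := (X in 0 <= X).
have -> : t = C * A * (1 - rho) * b'.
  by rewrite /t; field; rewrite !gt_eqF// subr_gt0.
by rewrite !mulr_ge0// ?subr_ge0 ltW.
Qed.

(** * Approximation by many small multiples *)

(** Halving needs a set stable under scaling, which [D] itself need not be. *)
Definition multiples {R : realType} {X : normedModType R} (D : set X) : set X :=
  [set v | exists a : R, exists2 d : X, D d & v = a *: d].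

(** Truncate the series to [L] terms and cut each into equal pieces of norm at most [(c + 1) / N],
    with [N] a large power of 2. The 1 added to [c] leaves room for rounding up the numbers of
    pieces. *)
Lemma ARS_sums_of (R : realType) (X : normedModType R) (c eps : R) (j : nat)
    (Y D : set X) (x : X) :
  0 < c -> is_ARS c Y D -> Y x -> `|x| <= 1 -> 0 < eps ->
  exists d : nat, exists2 y,
    sums_of (multiples D) ((c + 1) / (2 ^ (j + d))%:R) (2 ^ (j + d)) y &
    `|x - y| <= eps.
Proof.
move=> c0 [_ ars] Yx x1 eps0; have [a [d [Dd xE sumE]]] := ars _ Yx x1.
have /cvgrPdist_le/(_ _ eps0)[L _ /(_ L (leqnn _)) /= xL] := xE.
pose w i := `|a i *: d i|.
have w0 i : 0 <= w i by exact: normr_ge0.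
have wL : \sum_(0 <= i < L) w i <= c.
  rewrite -lee_fin -sumEFin; apply: le_trans sumE.
  by apply: nneseries_lim_ge => i _ _; rewrite lee_fin normr_ge0.
have C0 : 0 < c + 1 by lra.
(* Rounding up costs at most one piece per term, and [c * N / (c + 1) + L <= N] as soon as
   [(c + 1) * L <= N]. *)
pose M := Num.truncn ((c + 1) * L%:R).
have ML : (c + 1) * L%:R <= (2 ^ (j + M))%:R.
  apply/ltW/(lt_le_trans (truncnS_gt _)); rewrite ler_nat -/M.
  apply: leq_trans (ltn_expl M (ltnSn 1)) _.
  by rewrite leq_exp2l// leq_addl.
exists M; set N := (2 ^ _)%N in ML *.
have N0 : 0 < N%:R :> R by rewrite ltr0n expn_gt0.
pose t i := (Num.truncn (w i * N%:R / (c + 1))).+1.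
have t0 i : 0 < (t i)%:R :> R by rewrite ltr0n.
exists (\sum_(0 <= i < L) a i *: d i); last exact: xL.
exists (flatten [seq nseq (t i) ((t i)%:R^-1 *: (a i *: d i)) | i <- index_iota 0 L]).
split.
- rewrite size_flatten /shape -map_comp sumnE big_map.
  under eq_bigr do rewrite /= size_nseq.
  rewrite -(ler_nat R) natr_sum.
  apply: (@le_trans _ _ (\sum_(0 <= i < L) (w i * (N%:R / (c + 1)) + 1))).
    apply: ler_sum => i _; rewrite /t -natr1 lerD2r mulrA truncn_le.
    by rewrite divr_ge0// ?mulr_ge0// ltW.
  rewrite big_split /= -mulr_suml sumr_const_nat subn0.
  apply: (@le_trans _ _ (c * (N%:R / (c + 1)) + L%:R)).
    by rewrite lerD2r ler_wpM2r// divr_ge0// ltW.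
  rewrite [leRHS](_ : _ = c * (N%:R / (c + 1)) + N%:R / (c + 1)); last first.
    by field; rewrite gt_eqF.
  by rewrite lerD2l ler_pdivlMr// mulrC.
- move=> v /flatten_mapP[i _]; rewrite mem_nseq => /andP[_ /eqP ->]; split.
    by exists ((t i)%:R^-1 * a i); exists (d i); [exact: Dd|rewrite scalerA].
  rewrite normrZ ger0_norm ?invr_ge0//.
  rewrite mulrC ler_pdivrMr// -mulrA mulrC -ler_pdivrMr//.
  rewrite mulrC -/(w i) ler_pdivlMl// mulrA mulrC mulrA.
  exact/ltW/truncnS_gt.
- rewrite big_flatten big_map; apply: eq_bigr => i _.
  by rewrite big_nseq iter_addr_0 -scaler_nat scalerA mulfV ?scale1r// gt_eqF.
Qed.

(** * Iterating an approximation on the remainder *)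

(** Round [l] approximates the remainder [xs l], of norm at most [|x| / 2 ^ l], by [m] terms.
    Listing the rounds one after another gives the series, with decay 1/2 per [m] terms. *)
Lemma quick_series_of_half_approx (R : realType) (X : normedModType R) (G Y : set X)
    (r : R) (m : nat) (x : X) :
  (0 < m)%N -> 0 <= r -> linear_subspace Y -> G `<=` Y -> G 0 ->
  (forall x, Y x -> exists2 y, sums_of G (r * `|x|) m y & `|x - y| <= `|x| / 2) ->
  Y x -> exists g : nat -> X,
    [/\ forall i, G (g i), series g @ \oo --> x &
        forall i, `|g i| <= 2 * r * (1 - (2 * m%:R)^-1) ^+ i * `|x|].
Proof.
move=> m0 r0 Ysub GY G0 half Yx.
have /choice[F HF] : forall x, exists s : seq X, Y x ->
    [/\ (size s <= m)%N, {in s, forall v, G v /\ `|v| <= r * `|x|} &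
      `|x - \sum_(v <- s) v| <= `|x| / 2].
  move=> y; have [/half|nY] := pselect (Y y); last by exists [::].
  by case=> z [s [sm sG ->]] yz; exists s.
have YB y z : Y y -> Y z -> Y (y - z).
  move=> Yy Yz; have [_ /(_ (-1) z y)] := Ysub.
  by rewrite !inE scaleN1r addrC; apply.
have YD y z : Y y -> Y z -> Y (y + z).
  move=> Yy Yz; have [_ /(_ 1 y z)] := Ysub.
  by rewrite !inE scale1r; apply.
have Y0 : Y 0 by exact: GY.
pose next y := y - \sum_(v <- F y) v.
have Ynext y : Y y -> Y (next y).
  move=> Yy; apply: YB => //; have [_ FG _] := HF _ Yy.
  by rewrite big_seq; apply: (big_ind Y) => // v /FG[/GY].
pose xs l := iter l next x.
have Yxs l : Y (xs l) by elim: l => //= l; exact: Ynext.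
have xsle l : `|xs l| <= 2^-1 ^+ l * `|x|.
  elim: l => [|l IH]; first by rewrite expr0 mul1r.
  have [_ _ ] := HF _ (Yxs l); rewrite -/(next _) -[next _]/(xs l.+1).
  by rewrite exprS; move: IH; lra.
(* Short lists are padded by zeros, which lie in [G], so that every round has exactly [m] terms. *)
pose h y k := nth 0 (F y) k.
have hG y k : Y y -> G (h y k) /\ `|h y k| <= r * `|y|.
  move=> /HF[_ FG _]; rewrite /h; have [kF|kF] := ltnP k (size (F y)).
    exact/FG/mem_nth.
  by rewrite nth_default// normr0 mulr_ge0.
have hsum l : \sum_(0 <= k < m) h (xs l) k = xs l - xs l.+1.
  have [Fm _ _] := HF _ (Yxs l).
  rewrite (@big_cat_nat _ _ _ (size (F (xs l))))//= [X in _ + X]big1_seq; last first.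
    by move=> k; rewrite mem_index_iota => /andP[_ /andP[kF _]]; rewrite /h nth_default.
  by rewrite addr0 -(big_nth 0 predT id) /next opprB addrC subrK.
pose g i := h (xs (i %/ m)%N) (i %% m)%N.
(* By Bernoulli's inequality [q ^+ m >= 1/2], so this rate is slow enough to dominate one halving
   per round. *)
pose q : R := 1 - (2 * m%:R)^-1.
have m1 : 1 <= m%:R :> R by rewrite ler1n.
have i0 : 0 < (2 * m%:R)^-1 :> R by rewrite invr_gt0; lra.
have i1 : (2 * m%:R)^-1 <= 2^-1 :> R by rewrite lef_pV2 ?posrE; lra.
have q0 : 0 < q by rewrite /q; lra.
have q1 : q < 1 by rewrite /q; lra.
have qm : 2^-1 <= q ^+ m.
  apply: le_trans (bernoulli_sub _ _ _ (ltW i0) _); last by lra.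
  suff -> : m%:R * (2 * m%:R)^-1 = 2^-1 :> R by lra.
  by field; rewrite gt_eqF//; lra.
(* The factor 2 pays for the incomplete round, where [q ^+ (n %% m) >= 1/2]. *)
have powle n : 2^-1 ^+ (n %/ m) <= 2 * q ^+ n.
  rewrite {2}(divn_eq n m) exprD mulnC exprM.
  have : 2^-1 ^+ (n %/ m) <= q ^+ m ^+ (n %/ m).
    by apply: lerXn2r => //; rewrite nnegrE ?exprn_ge0// ltW.
  have : 2^-1 <= q ^+ (n %% m).
    apply: le_trans qm _; apply: ler_wiXn2l; rewrite ?ltW//.
    exact/ltnW/ltn_pmod.
  have : 0 <= 2^-1 ^+ (n %/ m) :> R by exact: exprn_ge0.
  move: (_ ^+ (n %/ m)) (_ ^+ (n %/ m)) (q ^+ _) => s1 s2 s3; nra.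
have gle i : `|g i| <= 2 * r * q ^+ i * `|x|.
  have [_ ] := hG _ (i %% m)%N (Yxs (i %/ m)%N).
  move=> /le_trans; apply; rewrite -!mulrA mulrCA ler_wpM2l// mulrA.
  by apply: le_trans (xsle _) _; rewrite ler_wpM2r.
exists g; split=> [i||//]; first by have [] := hG _ (i %% m)%N (Yxs (i %/ m)%N).
(* Complete rounds telescope to [x - xs l]; fewer than [m] terms of norm at most [r * |xs l|] are
   left over. *)
have dist n : `|x - series g n| <= 2 * (1 + m%:R * r) * `|x| * q ^+ n.
  pose l := (n %/ m)%N.
  have -> : x - series g n = xs l - \sum_(0 <= k < n %% m) h (xs l) k.
    have tail : \sum_(l * m <= i < n) g i = \sum_(0 <= k < n %% m) h (xs l) k.
      rewrite -{1}(add0n (l * m)%N) big_addn.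
      have -> : (n - l * m = n %% m)%N by rewrite /l {1}(divn_eq n m) addKn.
      apply: eq_big_nat => k /andP[_ kn].
      have km : (k < m)%N by apply: ltn_trans kn (ltn_pmod _ m0).
      by rewrite /g divnDMl// (addnC k) modnMDl divn_small// modn_small// add0n.
    have tele k : \sum_(0 <= i < k) (xs i - xs i.+1) = x - xs k.
      elim: k => [|k IH]; first by rewrite big_geq// subrr.
      by rewrite big_nat_recr//= IH addrA subrK.
    rewrite /series /=.
    rewrite (@big_cat_nat _ _ _ (l * m))//=; last exact: leq_trunc_div.
    rewrite tail big_nat_mul.
    under eq_bigr => i _.
      rewrite mulSn -{1}(add0n (i * m)%N) big_addn addnK.
      under eq_big_nat => k /andP[_ km].
        rewrite /g divnDMl// (addnC k) modnMDl divn_small// modn_small// add0n.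
        over.
      rewrite hsum; over.
    by rewrite tele opprD opprB addrA addrCA subrr addr0.
  have : `|\sum_(0 <= k < n %% m) h (xs l) k| <= m%:R * (r * `|xs l|).
    apply: le_trans (ler_norm_sum _ _ _) _.
    apply: (@le_trans _ _ (\sum_(0 <= k < n %% m) r * `|xs l|)).
      by apply: ler_sum => k _; have [] := hG _ k (Yxs l).
    rewrite sumr_const_nat subn0 -[leLHS]mulr_natl ler_wpM2r ?mulr_ge0//.
    by rewrite ler_nat ltnW// ltn_pmod.
  have := ler_normB (xs l) (\sum_(0 <= k < n %% m) h (xs l) k).
  move=> /le_trans H /(lerD (lexx `|xs l|))/H /le_trans; apply.
  have -> : `|xs l| + m%:R * (r * `|xs l|) = (1 + m%:R * r) * `|xs l| by ring.
  rewrite -!mulrA mulrCA ler_wpM2l//; first by rewrite addr_ge0// mulr_ge0.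
  apply: le_trans (xsle _) _; rewrite (mulrC `|x|) mulrA.
  by rewrite ler_wpM2r//; exact: powle.
apply/cvgrPdist_le => e e0.
have := @cvg_geometric R (2 * (1 + m%:R * r) * `|x|) q.
rewrite (ger0_norm (ltW q0)) => /(_ q1) /cvgrPdist_le/(_ _ e0).
apply: filterS => n; rewrite sub0r normrN /geometric /=.
by move/(le_trans (ler_norm _)); exact: le_trans.
Qed.

Lemma sums_ofZ (R : realType) (X : normedModType R) (G : set X) (r a : R)
    (K : nat) (y : X) :
  (forall a v, G v -> G (a *: v)) -> sums_of G r K y ->
  sums_of G (r * `|a|) K (a *: y).
Proof.
move=> GZ [s [sK sG ->]]; exists [seq a *: v | v <- s]; split.
- by rewrite size_map.
- move=> _ /mapP[v /sG[Gv vr] ->]; split; first exact: GZ.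
  by rewrite normrZ mulrC ler_wpM2r.
- by rewrite big_map scaler_sumr.
Qed.

Lemma exists_geometric_le (R : realType) (K q e : R) :
  0 <= q -> q < 1 -> 0 < e -> exists n, K * q ^+ n <= e.
Proof.
move=> q0 q1 e0; have := @cvg_geometric R K q.
rewrite (ger0_norm q0) => /(_ q1) /cvgrPdist_le/(_ _ e0)[n _ /(_ n (leqnn _))].
rewrite /= sub0r normrN /geometric /= => H; exists n.
exact: le_trans (ler_norm _) H.
Qed.

(** * From B-convexity to quick representation *)

Lemma B_convex_ARS_quick (R : realType) (X : normedModType R) (c : R) :
  B_convex X -> 1 <= c ->
  exists c1 q : R,
    [/\ 0 < c1, 0 < q, q < 1 &
        forall Y : set X, closed_subspace Y ->
        forall D : set X, is_ARS c Y D ->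
          is_quick_representing_system c1 q Y D].
Proof.
move=> /B_convex_sign_balanced[n /sign_balanced_exp2[A [rho [A1 rho0 rho1 Hb]]]] c1.
have C0 : 0 < c + 1 by lra.
have r10 : 0 < 1 - rho by lra.
(* This [j] depends only on [c], [A] and [rho]. The descent to [2 ^ j] terms then costs at most 1/4,
   whatever its starting size; another 1/4 is reserved for truncating the series. *)
have [j jE] := @exists_geometric_le _ ((c + 1) * A / (1 - rho)) rho 4^-1
  (ltW rho0) rho1 ltac:(lra).
pose m := (2 ^ j)%N.
have m0 : (0 < m)%N by rewrite expn_gt0.
have m1 : 1 <= m%:R :> R by rewrite ler1n.
pose r : R := (c + 1) / m%:R.
have r0 : 0 < r by apply: divr_gt0 => //; lra.
have i0 : 0 < (2 * m%:R)^-1 :> R by rewrite invr_gt0; lra.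
have i1 : (2 * m%:R)^-1 <= 2^-1 :> R by rewrite lef_pV2 ?posrE; lra.
exists (2 * r), (1 - (2 * m%:R)^-1); split; [lra..|].
move=> Y [Ysub _] D ars; split; first by case: ars.
have [DY ars'] := ars.
have [Y0 Ylin] := Ysub.
have {}Y0 : Y 0 by move: Y0; rewrite inE.
have YZ a y : Y y -> Y (a *: y).
  by move=> Yy; have := Ylin a y 0; rewrite !inE addr0; apply.
have GZ a v : multiples D v -> multiples D (a *: v).
  by case=> b [d Dd ->]; exists (a * b); exists d; rewrite ?scalerA.
have G0 : multiples D 0.
  have [|a [d [Dd _ _]]] := ars' _ Y0; first by rewrite normr0.
  by exists 0; exists (d 0%N); rewrite ?scale0r.
have GY : multiples D `<=` Y by move=> _ [a [d /DY Yd ->]]; exact: YZ.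
have half x : Y x ->
    exists2 y, sums_of (multiples D) (r * `|x|) m y & `|x - y| <= `|x| / 2.
  move=> Yx; have [->|x0] := eqVneq x 0.
    exists 0; last by rewrite subrr normr0 mul0r.
    by exists [::]; split; rewrite ?big_nil.
  have nx0 : 0 < `|x| by rewrite normr_gt0.
  have Yx' : Y (`|x|^-1 *: x) by exact: YZ.
  have x'1 : `| `|x|^-1 *: x| <= 1.
    by rewrite normrZ normfV normr_id mulVf// gt_eqF.
  have e0 : 0 < 4^-1 :> R by lra.
  have [d [y Hy xy]] := ARS_sums_of _ _ _ _ j _ _ _ (lt_le_trans ltr01 c1) ars Yx' x'1 e0.
  have [z Hz yz] := sums_of_descend _ _ _ _ _ _ _ _ _ GZ C0 (le_trans ler01 A1)
    rho0 rho1 Hb Hy.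
  exists (`|x| *: z); first by have := sums_ofZ _ _ _ _ `|x| _ _ GZ Hz; rewrite normr_id.
  have -> : x - `|x| *: z = `|x| *: (`|x|^-1 *: x - z).
    by rewrite scalerBr scalerA mulfV ?scale1r// gt_eqF.
  rewrite normrZ normr_id ler_wpM2l//.
  have -> : `|x|^-1 *: x - z = (`|x|^-1 *: x - y) + (y - z) by rewrite addrA subrK.
  apply: le_trans (ler_normD _ _) _.
  have : `|y - z| <= 4^-1.
    apply: le_trans yz _; apply: le_trans jE.
    rewrite [leRHS]mulrAC ler_pM2r ?invr_gt0//.
    rewrite ler_wpM2l ?mulr_ge0//; [lra..|].
    by rewrite lerBlDr lerDl exprn_ge0// ltW.
  by move: xy; lra.
move=> x Yx.
have [g [Gg gx gle]] :=
  quick_series_of_half_approx _ _ _ _ _ _ _ m0 (ltW r0) Ysub GY G0 half Yx.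
have /choice[ad adE] : forall i, exists p : R * X, D p.2 /\ g i = p.1 *: p.2.
  by move=> i; have [a [d Dd ->]] := Gg i; exists (a, d).
have gE : (fun i => (ad i).1 *: (ad i).2) = g.
  by apply/funext => i; have [] := adE i.
exists (fun i => (ad i).1), (fun i => (ad i).2); split.
- by move=> i; have [] := adE i.
- by rewrite gE.
- by move=> i; have [_ <-] := adE i.
Qed.

(** * Copies of l_1^n: closedness and basis *)

Lemma linear_rV_continuous (R : realType) (X : normedModType R) (n : nat)
    (T : {linear 'rV[R]_n -> X}) : continuous T.
Proof.
have -> : (T : 'rV[R]_n -> X) =
    fun v => \sum_(i < n) v 0 i *: T (delta_mx 0 i).
  apply/funext => v; rewrite {1}(row_sum_delta v) linear_sum.
  by apply: eq_bigr => i _; rewrite linearZ.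
apply: (continuous_big add_continuous) => i _ v; exact: (@cvgZr_tmp _ _ _ (nbhs v) _ _ _ _ (@coord_continuous R 1 n 0 i v)).
Qed.

Lemma ler_coord_l1norm (R : realType) (n : nat) (v : 'rV[R]_n) (i : 'I_n) :
  `|v 0 i| <= l1norm v.
Proof. by rewrite /l1norm (bigD1 i)//= lerDl sumr_ge0. Qed.

Lemma closed_range_l1 (R : realType) (X : normedModType R) (n : nat) (B : R)
    (T : {linear 'rV[R]_n -> X}) :
  0 <= B -> (forall v, l1norm v <= B * `|T v|) -> closed (range T).
Proof.
move=> B0 TB y yT.
(* The lower bound on [T] confines every [v] with [|y - T v| < 1] to the box of half-width [M],
   whose image is compact and hence closed. *)
pose M := B * (`|y| + 1).
have Kc := @rV_compact (R : ptopologicalType) n (fun=> `[(- M), M]%classic) (fun=> @segment_compact R _ _).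
pose K := [set v : 'rV[R]_n | forall i, `[(- M), M]%classic (v ord0 i)].
have TK : closed (T @` K).
  apply: compact_closed; first exact: norm_hausdorff.
  apply: continuous_compact => //.
  exact/continuous_subspaceT/linear_rV_continuous.
suff /TK[v _ <-] : closure (T @` K) y by exists v.
move=> U Uy.
have [_ [[v _ <-] [Uv]]] := yT (U `&` ball y 1) (filterI Uy (nbhsx_ballx y 1 ltr01)).
rewrite -ball_normE /= => yv; exists (T v); split=> //; exists v => // i.
rewrite /= in_itv /= -ler_norml.
apply: le_trans (ler_coord_l1norm _ _ _ _) _; apply: le_trans (TB v) _.
rewrite ler_wpM2l//; have -> : T v = y - (y - T v) by rewrite opprB addrC subrK.
by apply: le_trans (ler_normB _ _) _; rewrite lerD2l ltW.
Qed.

Lemma geometric_tail (R : realType) (X : normedModType R) (g : nat -> X) (x : X)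
    (K q : R) (N : nat) :
  0 <= K -> 0 < q -> q < 1 -> (forall i, `|g i| <= K * q ^+ i) ->
  series g @ \oo --> x -> `|x - series g N| <= K * q ^+ N / (1 - q).
Proof.
move=> K0 q0 q1 gle gx.
have q10 : 0 < 1 - q by lra.
have part d : `|series g (N + d)%N - series g N| <=
    K * (q ^+ N - q ^+ (N + d)) / (1 - q).
  elim: d => [|d IH]; first by rewrite addn0 !subrr normr0 mulr0 mul0r.
  rewrite addnS {1}/series /= big_nat_recr ?leq0n//= addrAC.
  apply: le_trans (ler_normD _ _) _; apply: le_trans (lerD IH (gle _)) _.
  rewrite le_eqVlt; apply/orP; left; apply/eqP.
  by rewrite exprS; field; rewrite gt_eqF.
apply/ler_addgt0Pl => e e0.
have /cvgrPdist_le/(_ _ e0)[n _ /(_ (N + n)%N (leq_addl _ _)) /= H] := gx.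
have -> : x - series g N = (x - series g (N + n)%N) +
    (series g (N + n)%N - series g N) by rewrite addrA subrK.
apply: le_trans (ler_normD _ _) _; rewrite lerD//.
apply: le_trans (part n) _; rewrite ler_pM2r ?invr_gt0//.
by rewrite ler_wpM2l// lerBlDr lerDl exprn_ge0// ltW.
Qed.

(** In the basis expansion of [T v] the norms of the terms add up to at most
    [A * l1norm v <= A * B * |T v|]. *)
Lemma l1_basis_ARS (R : realType) (X : normedModType R) (n : nat) (A B c : R)
    (T : {linear 'rV[R]_n -> X}) :
  (0 < n)%N -> 0 <= A -> 0 <= B -> A * B <= c ->
  (forall v, `|T v| <= A * l1norm v) -> (forall v, l1norm v <= B * `|T v|) ->
  is_ARS c (range T) [set T (delta_mx 0 i) | i in [set: 'I_n]].
Proof.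
move=> n0 A0 B0 ABc TA TB; split; first by move=> _ [i _ <-]; exists (delta_mx 0 i).
move=> _ [v _ <-] Tv1.
(* The finite expansion must become an infinite series over the basis: past [n] the index defaults
   to 0 and the coefficient [a k] vanishes. *)
pose s k : 'I_n := insubd (Ordinal n0) k.
have sE (i : 'I_n) : s i = i by exact: valKd.
pose a k := if (k < n)%N then v 0 (s k) else 0.
have aE (i : 'I_n) : a i = v 0 i by rewrite /a ltn_ord sE.
have a0 k : (n <= k)%N -> a k = 0 by rewrite /a ltnNge => ->.
exists a, (fun k => T (delta_mx 0 (s k))); split.
- by move=> k; exists (s k).
- apply: cvg_near_cst; exists n => // k /= nk.
  rewrite /series /= (@big_cat_nat _ _ _ n)//= [X in _ + X]big1_seq ?addr0; last first.
    by move=> i /andP[_]; rewrite mem_index_iota => /andP[ni _]; rewrite a0 ?scale0r.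
  rewrite big_mkord [in RHS](row_sum_delta v) linear_sum.
  by apply: eq_bigr => i _; rewrite aE sE linearZ.
- apply: lime_le; first by apply: is_cvg_nneseries => i _ _; rewrite lee_fin.
  exists n => // k /= nk; rewrite sumEFin lee_fin.
  rewrite (@big_cat_nat _ _ _ n)//= [X in _ + X]big1_seq ?addr0; last first.
    move=> i /andP[_]; rewrite mem_index_iota => /andP[ni _].
    by rewrite a0 ?scale0r ?normr0.
  rewrite big_mkord; apply: (@le_trans _ _ (A * l1norm v)).
    rewrite /l1norm mulr_sumr; apply: ler_sum => i _.
    rewrite aE sE normrZ mulrC ler_wpM2r//.
    apply: le_trans (TA _) _; rewrite -[leRHS]mulr1 ler_wpM2l//.
    rewrite /l1norm (bigD1 i)//= mxE !eqxx normr1 big1 ?addr0// => k' /negbTE ki.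
    by rewrite mxE eqxx ki normr0.
  apply: le_trans ABc; apply: le_trans (ler_wpM2l A0 (TB v)) _.
  by rewrite mulrA ler_piMr// mulr_ge0.
Qed.

(** * From quick representation to B-convexity *)

Lemma quick_not_l1n_uniformly (R : realType) (X : normedModType R) :
  (forall c : R, 1 <= c ->
    exists c1 q : R,
      [/\ 0 < c1, 0 < q, q < 1 &
          forall Y : set X, closed_subspace Y ->
          forall D : set X, is_ARS c Y D ->
            is_quick_representing_system c1 q Y D]) ->
  ~ contains_l1n_uniformly X.
Proof.
move=> H [lam l1n]; pose c := Num.max lam 1.
have c1 : 1 <= c by rewrite /c le_max lexx orbT.
have [c2 [q [c20 q0 q1 Hc]]] := H c c1.
have q10 : 0 < 1 - q by lra.
(* With [N = N0 + 1 > 0] the tail factor [c * c2 * q ^+ N / (1 - q)] is at most 1/4. Dimension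
   [2 * N] ensures that [N] terms miss at least [N] coordinates. *)
have [N0 N0E] := @exists_geometric_le _ (c * c2 * q / (1 - q)) q 4^-1
  (ltW q0) q1 ltac:(lra).
pose N := N0.+1; pose n := (2 * N)%N.
have [E [Esub [T [[TE _ Tsurj] [A [B [A0 B0 TA TB AB]]]]]]] := l1n n isT.
have {TE Tsurj}EE : E = range T.
  apply/seteqP; split=> [x /Tsurj//|x [v _ <-]]; exact: TE.
have ABc : A * B <= c by apply: le_trans AB _; rewrite /c le_max lexx.
have Ecl : closed_subspace E by split=> //; rewrite EE; exact: closed_range_l1 B0 TB.
have := l1_basis_ARS _ _ _ _ _ _ T isT A0 B0 ABc TA TB; rewrite -EE.
move=> /(Hc _ Ecl)[_ quick].
pose v1 : 'rV[R]_n := const_mx 1.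
have [|a [d [Dd dx dle]]] := quick (T v1); first by rewrite EE; exists v1.
have /choice[s sE] : forall k, exists i : 'I_n, T (delta_mx 0 i) = d k.
  by move=> k; have [i _ iE] := Dd k; exists i.
pose u : 'rV[R]_n := \sum_(0 <= k < N) a k *: delta_mx 0 (s k).
have uE : series (fun k => a k *: d k) N = T u.
  rewrite /series /= /u linear_sum; apply: eq_bigr => k _.
  by rewrite linearZ sE.
have Tx : `|T v1| <= A * n%:R.
  apply: le_trans (TA _) _; rewrite ler_wpM2l// /l1norm.
  under eq_bigr do rewrite mxE normr1.
  by rewrite sumr_const card_ord.
(* The partial sum [u] involves at most [N] basis vectors, and [v1 - u] equals 1 at every other
   coordinate. *)
have far : N%:R <= l1norm (v1 - u).
  pose S := [seq s k | k <- iota 0 N].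
  have SN : (N <= #|[predC S]|)%N.
    have nE : (#|S| + #|[predC S]|)%N = (N + N)%N.
      by rewrite cardC card_ord /n mul2n addnn.
    have SleN : (#|S| <= N)%N.
      by apply: leq_trans (card_size _) _; rewrite size_map size_iota.
    by rewrite -(leq_add2l #|S|) nE leq_add2r.
  apply: (@le_trans _ _ (#|[predC S]|%:R)); first by rewrite ler_nat.
  rewrite -sumr_const /l1norm [leRHS](bigID [in [predC S]])/= -[leLHS]addr0.
  rewrite lerD ?sumr_ge0//; apply: ler_sum => i iS.
  rewrite !mxE summxE big1_seq ?subr0 ?normr1// => k /andP[_].
  rewrite mem_index_iota => kN; rewrite !mxE eqxx /=.
  suff /negbTE -> : i != s k by rewrite mulr0.
  apply: contraNN iS => /eqP ->; apply/mapP; exists k => //.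
  by rewrite mem_iota add0n.
have := @geometric_tail _ _ _ _ (c2 * `|T v1|) q N _ q0 q1 _ dx.
rewrite uE -linearB => tail.
have {}tail : `|T (v1 - u)| <= c2 * `|T v1| * q ^+ N / (1 - q).
  apply: tail => [|i]; first by rewrite mulr_ge0// ltW.
  by rewrite mulrAC.
have P0 : 0 <= c2 * q ^+ N / (1 - q).
  by rewrite !mulr_ge0 ?invr_ge0 ?exprn_ge0 ?ltW.
(* Lower bound, tail and upper bound combine to [N <= n / 4 = N / 2], which is absurd. *)
have : N%:R <= B * (c2 * q ^+ N / (1 - q) * (A * n%:R)).
  apply: le_trans far _; apply: le_trans (TB _) _; rewrite ler_wpM2l//.
  apply: le_trans tail _; rewrite [leLHS](_ : _ = c2 * q ^+ N / (1 - q) * `|T v1|).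
    by rewrite ler_wpM2l.
  by ring.
have -> : B * (c2 * q ^+ N / (1 - q) * (A * n%:R)) =
    (A * B) * (c2 * q ^+ N / (1 - q)) * n%:R by ring.
have : (A * B) * (c2 * q ^+ N / (1 - q)) <= 4^-1.
  apply: le_trans (ler_wpM2r P0 ABc) _; apply: le_trans N0E.
  rewrite le_eqVlt; apply/orP; left; apply/eqP.
  by rewrite exprS; ring.
have N1 : 1 <= N%:R :> R by rewrite ler1n.
rewrite /n natrM; move: (_ * (_ / _)) => z z4.
have : z * (2 * N%:R) <= 4^-1 * (2 * N%:R) by rewrite ler_wpM2r//; lra.
lra.
Qed.

Theorem mainTheorem3 (R : realType) (X : completeNormedModType R) :
  B_convex X <->
  (forall c : R, 1 <= c ->
    exists c1 q : R,
      [/\ 0 < c1, 0 < q, q < 1 &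
          forall Y : set X, closed_subspace Y ->
          forall D : set X, is_ARS c Y D ->
            is_quick_representing_system c1 q Y D]).
Proof.
split=> [bX c|]; first exact: B_convex_ARS_quick.
exact: quick_not_l1n_uniformly.
Qed.
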